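(* Let $C=(\Pi_\infty,\rho)$ be a self-similar ultrametric Cantor set, and let $\dim_H(C)$ be its Hausdorff dimension. Then there exists a bi-Lipschitz embedding $$C\hookrightarrow\mathbb{R}^{[\dim_H(C)]+1},$$ where $[\dim_H(C)]$ denotes the integer part of $\dim_H(C)$; that is, there exist a map $F:C\to\mathbb{R}^{[\dim_H(C)]+1}$ and constants $0<c_-\le c_+$ such that $c_-\rho(x,y)\le\|F(x)-F(y)\|\le c_+\rho(x,y)$ for all $x,y\in C$.
   Context: Stationary Bratteli diagram: given finite sets $\mathcal{V}$, $\mathcal{E}$ and maps $s,r:\mathcal{E}\to\mathcal{V}$ (source, range), it is the infinite oriented graph with vertex levels $V_0=\{\circ\}$ (root) and $V_n$ a copy of $\mathcal{V}$ for $n\ge1$, and edge levels $E_0$, consisting of exactly one edge from $\circ$ to each vertex of $V_1$, and, for $n\ge 1$, $E_n$ a copy of $\mathcal{E}$, where $e\in\mathcal{E}$ goes from the copy of $s(e)$ in $V_n$ to the copy of $r(e)$ in $V_{n+1}$. Paths: a finite path of length $|\gamma|=n$ is $\gamma=(e_0,\dots,e_{n-1})$ from the root to $V_n$ ($e_j\in E_j$, $r(e_j)=s(e_{j+1})$), including the empty path for $n=0$; $\Pi$ is the set of finite paths; $\Pi_\infty$ is the set of infinite paths, with the topology induced by the product of the discrete topologies on the $E_j$. For $x\ne y$ in $\Pi_\infty$, $x\wedge y\in\Pi$ is the longest common prefix. Self-similar ultrametric Cantor set: such a $\Pi_\infty$ which is a Cantor set (nonempty, compact, totally disconnected, no isolated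 points), with an ultrametric $\rho$ of the form $\rho(x,y)=a_{x\wedge y}\,\alpha^{|x\wedge y|}$ for $x\neq y$, $\rho(x,x)=0$, where $\alpha\in(0,1)$ (the parameter of $\rho$), $a_\gamma\in(0,\infty)$ for $\gamma\in\Pi$, $0<\inf_{\gamma\in\Pi}a_\gamma\le\sup_{\gamma\in\Pi}a_\gamma<\infty$, and the weight $\gamma\mapsto a_\gamma\alpha^{|\gamma|}$ is non-increasing under extension of $\gamma$. *)

(* Defs.v *)
From HB Require Import structures.
From mathcomp Require Import all_boot all_order all_algebra.
From mathcomp Require Import all_classical all_reals all_analysis.

Set Implicit Arguments.
Unset Strict Implicit.
Unset Printing Implicit Defensive.

Import Order.TTheory GRing.Theory Num.Theory.
Import numFieldNormedType.Exports.

Local Open Scope classical_set_scope.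
Local Open Scope ring_scope.

Section StationaryBratteli.
Variables (V E : finType) (s r : E -> V).

(* The root emits exactly one edge to each vertex of V_1, so the edge of E_0
   ending at v is identified with v itself. *)
Definition level_edge (n : nat) : finType := if n is 0 then V else E.

Definition level_range (n : nat) : level_edge n -> V :=
  match n with 0 => id | _.+1 => r end.

Definition level_source (n : nat) : level_edge n.+1 -> V := s.

Definition edge_sequence : Type :=
  prod_topology (fun n => discrete_topology (level_edge n)).

Definition is_infinite_path : set edge_sequence :=
  [set x | forall n, level_range (x n : level_edge n) =
                     level_source (x n.+1 : level_edge n.+1)].

(* [set_type] carries the topology induced by [edge_sequence]. *)
Definition infinite_path : Type := set_type is_infinite_path.

(* [None] is the empty path; [Some (v, [:: e_1; ...; e_m])] is the path of
   length m + 1 whose edge in E_0 ends at v. *)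
Definition raw_path : Type := option (V * seq E).

Fixpoint is_walk (v : V) (p : seq E) : bool :=
  if p is e :: q then (s e == v) && is_walk (r e) q else true.

Definition finite_path : set raw_path :=
  [set g | if g is Some (v, p) then is_walk v p else true].

Definition path_length (g : raw_path) : nat :=
  if g is Some (_, p) then (size p).+1 else 0.

Definition extends (g h : raw_path) : Prop :=
  match g, h with
  | None, _ => True
  | Some (v, p), Some (w, q) => v = w /\ prefix p q
  | Some _, None => False
  end.

Definition truncation (x : infinite_path) (n : nat) : raw_path :=
  if n is m.+1 then
    Some (set_val x 0 : V, mkseq (fun i => set_val x i.+1 : E) m)
  else None.

Definition is_prefix (g : raw_path) (x : infinite_path) : Prop :=
  g = truncation x (path_length g).

Definition longest_common_prefix (x y : infinite_path) (g : raw_path) : Prop :=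
  [/\ is_prefix g x, is_prefix g y &
      forall h, is_prefix h x -> is_prefix h y ->
        (path_length h <= path_length g)%N].

End StationaryBratteli.

Definition cantor_set (T : topologicalType) : Prop :=
  [/\ [set: T] !=set0, compact [set: T], totally_disconnected [set: T]
    & isolated [set: T] = set0].

Definition ultrametric (R : realType) (T : Type) (d : T -> T -> R) : Prop :=
  [/\ forall x y, 0 <= d x y,
      forall x y, d x y = 0 <-> x = y,
      forall x y, d x y = d y x
    & forall x y z, d x z <= Num.max (d x y) (d y z)].

(* The weights are indexed by all raw paths, but only their values on
   [finite_path] are constrained or used. *)
Definition self_similar_ultrametric (R : realType) (V E : finType)
    (s r : E -> V) (alpha : R)
    (rho : infinite_path s r -> infinite_path s r -> R) : Prop :=
  [/\ ultrametric rho, 0 < alpha < 1 &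
    exists a : raw_path V E -> R,
      [/\ forall g, finite_path s r g -> 0 < a g,
          (0 < ereal_inf [set (a g)%:E | g in finite_path s r])%E,
          (ereal_sup [set (a g)%:E | g in finite_path s r] < +oo)%E,
          forall g h, finite_path s r g -> finite_path s r h -> extends g h ->
            a h * alpha ^+ path_length h <= a g * alpha ^+ path_length g
        & forall x y g, x <> y -> longest_common_prefix x y g ->
            rho x y = a g * alpha ^+ path_length g]].

Section Hausdorff.
Variables (R : realType) (T : Type) (d : T -> T -> R).
Local Open Scope ereal_scope.

(* The maximum with 0 only matters for the empty set. *)
Definition diameter (A : set T) : \bar R :=
  maxe 0 (ereal_sup [set (d x y)%:E | x in A & y in A]).

(* As 0 `^ 0 = 1, this makes the 0-dimensional measure the counting measure;
   the empty set contributes nothing. *)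
Definition gauge (t : R) (A : set T) : \bar R :=
  if A == set0 then 0 else diameter A `^ t.

Definition hausdorff_content (delta t : R) (A : set T) : \bar R :=
  ereal_inf [set \sum_(0 <= i <oo) gauge t (U i) | U in
    [set U : nat -> set T | A `<=` \bigcup_i U i /\
                            forall i, diameter (U i) <= delta%:E]].

Definition hausdorff_measure (t : R) (A : set T) : \bar R :=
  ereal_sup [set hausdorff_content delta t A | delta in [set x | (0 < x)%R]].

Definition hausdorff_dim : \bar R :=
  ereal_inf [set t%:E | t in
    [set t | (0 <= t)%R /\ hausdorff_measure t [set: T] = 0]].

End Hausdorff.

Definition euclidean_norm (R : realType) (n : nat) (v : 'rV[R]_n) : R :=
  Num.sqrt (\sum_(i < n) v 0 i ^+ 2).

(* Main.v *)
(* The length-k words occurring in the edge sequences of infinite paths form a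
   shift-invariant family, and rho is comparable to alpha ^ k, where k is the
   first index at which the edges of two paths differ. If the t-dimensional
   Hausdorff measure vanishes, compactness yields a finite cover by cylinders
   of words w with \sum_w (alpha `^ t) ^ |w| <= 1; splitting a live word along
   this cover shows inductively that the number of live words of length n is
   O(alpha `^ (- t * n)). As some such t is less than m = [dim_H] + 1, for K
   large the live words of length K inject into a grid {0, ..., M - 1} ^ m with
   M of order alpha ^ (- K). Reading a path by blocks of length K, these grid
   points are the digits of an expansion in base alpha ^ (- K); M is small
   enough compared with the base for distinct expansions to separate at the
   scale of their first distinct digit. *)
From mathcomp Require Import zify ring lra.
Require Import Defs.
From mathcomp Require Import all_boot all_order all_algebra.
From mathcomp Require Import all_classical all_reals all_analysis.
Import Order.TTheory GRing.Theory Num.Theory.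
Import numFieldNormedType.Exports.
Local Open Scope classical_set_scope.
Local Open Scope ring_scope.

(** * Counting live words by means of prefix covers *)

Definition edge_path {V E : finType} (s r : E -> V) (e : nat -> E) : Prop :=
  forall n, r (e n) = s (e n.+1).

(** Words that cannot be continued forever are excluded, as no infinite path sees them. Requiring
    the word at the start of [e] loses nothing: a shift of an edge path is again an edge path. *)
Definition live_word {V E : finType} (s r : E -> V) (w : seq E) : Prop :=
  exists2 e, edge_path s r e & w = mkseq e (size w).

Definition live_words {V E : finType} (s r : E -> V) (n : nat) :
  {set n.-tuple E} := [set w | `[< live_word s r (tval w) >]]%SET.

Definition prefix_cover {V E : finType} (s r : E -> V) (G : seq (seq E)) :=
  forall e, edge_path s r e -> exists2 w, w \in G & w = mkseq e (size w).

Lemma live_wordsE {V E : finType} (s r : E -> V) n (w : n.-tuple E) :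
  w \in live_words s r n -> live_word s r w.
Proof. by rewrite inE => /asboolP. Qed.

Lemma edge_path_shift {V E : finType} {s r : E -> V} {e : nat -> E} (k : nat) :
  edge_path s r e -> edge_path s r (fun i => e (k + i)%N).
Proof. by move=> pe n; rewrite addnS; exact: pe. Qed.

Lemma drop_mkseq (T : Type) (e : nat -> T) (k n : nat) :
  drop k (mkseq e n) = mkseq (fun i => e (k + i)%N) (n - k).
Proof.
rewrite /mkseq -map_drop drop_iota addnC iotaDl -map_comp.
by apply: eq_map => i /=.
Qed.

(** A live word of length n is the start of an infinite edge path, so it begins with some w in [G].
    Erasing w leaves a live word of length n - |w|, and for fixed w the erasure is injective. *)
Lemma card_live_words_cover {V E : finType} {s r : E -> V} {G : seq (seq E)}
    {n : nat} :
  prefix_cover s r G -> (forall w, w \in G -> (size w <= n)%N) ->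
  (#|live_words s r n| <= \sum_(w <- G) #|live_words s r (n - size w)|)%N.
Proof.
move=> coverG sizeG.
pose A (w : seq E) : {set n.-tuple E} :=
  [set u in live_words s r n | prefix w u]%SET.
have subA : live_words s r n \subset [set u | has (fun w => u \in A w) G]%SET.
  apply/fintype.subsetP => u uL; have [e pe eu] := live_wordsE _ _ _ _ uL.
  have [w wG ew] := coverG e pe.
  have := sizeG _ wG => szw.
  rewrite inE; apply/hasP; exists w => //.
  rewrite inE uL /= prefixE eu size_tuple.
  by rewrite {2}ew /mkseq -map_take take_iota (minn_idPl szw) eqxx.
apply: leq_trans (subset_leq_card subA) _.
have cardA w : (#|A w| <= #|live_words s r (n - size w)|)%N.
  pose f (u : n.-tuple E) : (n - size w).-tuple E := [tuple of drop (size w) u].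
  have injf : {in A w &, injective f}.
    move=> u v; rewrite !inE => /andP[_ /prefixP [u' eu]] /andP[_ /prefixP [v' ev]].
    move/(congr1 val) => /=.
    by rewrite eu ev !drop_size_cat // => e; apply/val_inj; rewrite /= eu ev e.
  rewrite -(card_in_imset injf); apply: subset_leq_card; apply/fintype.subsetP => v.
  case/imsetP => u; rewrite inE => /andP[/live_wordsE [e pe eu] _ ->].
  rewrite inE; apply/asboolP; exists (fun i => e (size w + i)%N).
    exact: edge_path_shift.
  by rewrite /= size_drop {1}eu drop_mkseq.
elim: G {coverG sizeG subA} => [|w G IH].
  by rewrite big_nil eq_card0 // => u; rewrite !inE.
rewrite big_cons; apply: leq_trans (leq_add (cardA w) IH).
apply: leq_trans (subset_leq_card _) (leq_card_setU _ _).1.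
by apply/fintype.subsetP => u; rewrite !inE /= !inE.
Qed.

(** Strong induction on n: weighted by [l ^+ n], the recursion of [card_live_words_cover] bounds the
    count by C times the sum of the [l ^+ size w], which is at most C. Nonempty words make the
    recursion descend. *)
Lemma live_words_growth (R : realType) {V E : finType} (s r : E -> V)
    (G : seq (seq E)) (l : R) :
  0 < l <= 1 -> prefix_cover s r G -> (forall w, w \in G -> (0 < size w)%N) ->
  \sum_(w <- G) l ^+ size w <= 1 ->
  exists2 C : R, 0 < C & forall n, #|live_words s r n|%:R * l ^+ n <= C.
Proof.
move=> /andP[l0 l1] coverG sizeG sumG.
pose L := (\sum_(w <- G) size w)%N.
have szL w : w \in G -> (size w <= L)%N.
  by move=> wG; rewrite /L (big_rem _ wG) /= leq_addr.
(* The recursion applies only when n is at least every word length in [G]; the sum in [C] takes care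
   of all smaller n. *)
pose C : R := 1 + \sum_(i < L) #|live_words s r i|%:R.
have C0 : 0 < C by rewrite ltr_pwDl // sumr_ge0.
exists C => //; elim/ltn_ind => n IH.
have [nL|Ln] := ltnP n L.
  apply: (@le_trans _ _ #|live_words s r n|%:R).
    by rewrite ler_piMr // exprn_ile1 // ltW.
  rewrite /C (bigD1 (Ordinal nL)) //= addrCA lerDl.
  by rewrite addr_ge0 // sumr_ge0.
have szn w : w \in G -> (size w <= n)%N by move=> /szL /leq_trans; apply.
have := card_live_words_cover coverG szn.
rewrite -(ler_nat R) natr_sum => /(ler_wpM2r (exprn_ge0 n (ltW l0))) /le_trans.
apply; rewrite mulr_suml.
apply: (@le_trans _ _ (\sum_(w <- G) C * l ^+ size w)); last first.
  by rewrite -mulr_sumr ler_piMr // ltW.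
rewrite big_seq [leRHS]big_seq; apply: ler_sum => w wG.
rewrite -[X in _ * l ^+ X <= _](subnK (szn w wG)) exprD mulrA.
rewrite ler_wpM2r ?exprn_ge0 ?(ltW l0) //.
by apply: IH; rewrite ltn_subrL sizeG //= (leq_trans (sizeG w wG)) ?szn.
Qed.

(** * Coordinate bounds for the norm, and expansions in base 1/b *)

Lemma euclidean_norm_ge {R : realType} {n : nat} (v : 'rV[R]_n) (i : 'I_n) :
  `|v 0 i| <= euclidean_norm v.
Proof.
rewrite /euclidean_norm -sqrtr_sqr ler_wsqrtr // (bigD1 i) //= lerDl.
by apply: sumr_ge0 => j _; exact: sqr_ge0.
Qed.

Lemma euclidean_norm_le {R : realType} {n : nat} (v : 'rV[R]_n) (B : R) :
  0 <= B -> (forall i, `|v 0 i| <= B) -> euclidean_norm v <= n%:R * B.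
Proof.
move=> B0 vB; rewrite /euclidean_norm.
have nB0 : 0 <= n%:R * B by rewrite mulr_ge0.
rewrite -[leRHS](ger0_norm nB0) -sqrtr_sqr ler_wsqrtr // exprMn.
apply: (@le_trans _ _ (\sum_(i < n) B ^+ 2)).
  by apply: ler_sum => i _; rewrite -real_normK ?num_real // lerXn2r ?nnegrE.
rewrite sumr_const card_ord -[leLHS]mulr_natl ler_wpM2r ?sqr_ge0 //.
by rewrite -natrX ler_nat; case: n {v vB nB0} => // n; exact: leq_pmulr.
Qed.

(** Padding the sum to n + k terms treats n < k and n >= k alike. The terms beyond k are then
    dominated by a geometric sum, kept in closed form so that the induction closes by an
    identity. *)
Lemma digit_sum_tail {R : realType} (b B : R) (d : nat -> R) (k n : nat) :
  0 < b < 1 -> (forall i, 0 <= d i <= B) ->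
  \sum_(i < n) d i * b ^+ i <=
    \sum_(i < k) d i * b ^+ i + B * b ^+ k / (1 - b).
Proof.
move=> /andP[b0 b1] dB.
have B0 : 0 <= B by have /andP[/le_trans] := dB 0%N; apply.
have b1' : 0 < 1 - b by rewrite subr_gt0.
have pos i : 0 <= d i * b ^+ i.
  by rewrite mulr_ge0 ?exprn_ge0 ?(ltW b0) //; case/andP: (dB i).
have incr m : \sum_(i < n) d i * b ^+ i <= \sum_(i < n + m) d i * b ^+ i.
  elim: m => [|m IH]; first by rewrite addn0.
  by rewrite addnS big_ord_recr /=; rewrite (le_trans IH) // lerDl.
have tail m : \sum_(i < k + m) d i * b ^+ i <=
    \sum_(i < k) d i * b ^+ i + B * (b ^+ k - b ^+ (k + m)) / (1 - b).
  elim: m => [|m IH]; first by rewrite addn0 subrr mulr0 mul0r addr0.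
  rewrite addnS big_ord_recr /=; apply: (le_trans (lerD IH (lexx _))).
  rewrite -addrA lerD2l.
  have dle : d (k + m)%N * b ^+ (k + m) <= B * b ^+ (k + m).
    by rewrite ler_wpM2r ?exprn_ge0 ?(ltW b0) //; case/andP: (dB (k + m)%N).
  apply: (le_trans (lerD (lexx _) dle)); rewrite exprS le_eqVlt; apply/orP; left.
  by apply/eqP; field; rewrite gt_eqF.
apply: (le_trans (incr k)); rewrite addnC; apply: (le_trans (tail n)).
rewrite lerD2l ler_wpM2r ?invr_ge0 ?(ltW b1') // ler_wpM2l // gerBl.
by rewrite exprn_ge0 // ltW.
Qed.

(* The partial sums are non-decreasing and bounded for digits in [0, B] and
   0 < b < 1, so this supremum is the sum of the series. *)
Definition digit_value {R : realType} (b : R) (d : nat -> R) : R :=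
  sup (range (fun n => \sum_(i < n) d i * b ^+ i)).

Lemma digit_value_bounds {R : realType} (b B : R) (d : nat -> R) (k : nat) :
  0 < b < 1 -> (forall i, 0 <= d i <= B) ->
  \sum_(i < k) d i * b ^+ i <= digit_value b d <=
    \sum_(i < k) d i * b ^+ i + B * b ^+ k / (1 - b).
Proof.
move=> b01 dB; apply/andP; split.
  apply: ub_le_sup; last by exists k.
  exists (\sum_(i < 0) d i * b ^+ i + B * b ^+ 0 / (1 - b)).
  by move=> _ [n _ <-]; exact: digit_sum_tail.
apply: ge_sup; first by exists (\sum_(i < 0) d i * b ^+ i), 0%N.
by move=> _ [n _ <-]; exact: digit_sum_tail.
Qed.

Lemma digit_value_upper {R : realType} (b B : R) (d d' : nat -> R) (k : nat) :
  0 < b < 1 -> (forall i, 0 <= d i <= B) -> (forall i, 0 <= d' i <= B) ->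
  (forall i, (i < k)%N -> d i = d' i) ->
  `|digit_value b d - digit_value b d'| <= B * b ^+ k / (1 - b).
Proof.
move=> b01 dB dB' dd'.
have /andP[l1 u1] := digit_value_bounds b B d k b01 dB.
have /andP[l2 u2] := digit_value_bounds b B d' k b01 dB'.
have e : \sum_(i < k) d i * b ^+ i = \sum_(i < k) d' i * b ^+ i.
  by apply: eq_bigr => i _; rewrite dd'.
by rewrite ler_norml; move: l1 u1 l2 u2; rewrite e; move: (B * _ / _) => c; lra.
Qed.

(** The first distinct digits contribute at least b^k to the difference. Each remaining tail lies
    between 0 and B b^(k+1) / (1 - b), which is at most (1/3) / (5/6) = 2/5 of b^k, so at least half
    of b^k survives. *)
Lemma digit_value_lower {R : realType} (b B : R) (d d' : nat -> R) (k : nat) :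
  0 < b -> b <= 6^-1 -> B * b <= 3^-1 ->
  (forall i, 0 <= d i <= B) -> (forall i, 0 <= d' i <= B) ->
  (forall i, (i < k)%N -> d i = d' i) -> 1 <= `|d k - d' k| ->
  b ^+ k / 2 <= `|digit_value b d - digit_value b d'|.
Proof.
move=> b0 b6 Bb dB dB' dd' dk.
have b01 : 0 < b < 1 by rewrite b0 /=; lra.
have /andP[l1 u1] := digit_value_bounds b B d k.+1 b01 dB.
have /andP[l2 u2] := digit_value_bounds b B d' k.+1 b01 dB'.
have e : \sum_(i < k) d i * b ^+ i = \sum_(i < k) d' i * b ^+ i.
  by apply: eq_bigr => i _; rewrite dd'.
move: l1 u1 l2 u2; rewrite !big_ord_recr /= e.
have bk0 : 0 < b ^+ k by rewrite exprn_gt0.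
have tl : B * b ^+ k.+1 / (1 - b) <= b ^+ k / 2.
  rewrite exprS mulrA ler_pdivrMr; last by lra.
  by nra.
move: (B * _ / _) tl (\sum_(i < k) _) => c cle S l1 u1 l2 u2.
have : b ^+ k <= `|d k * b ^+ k - d' k * b ^+ k|.
  by rewrite -mulrBl normrM (gtr0_norm bk0) ler_peMl // ltW.
move: (d k * b ^+ k) (d' k * b ^+ k) l1 u1 l2 u2 => p q l1 u1 l2 u2.
rewrite !ler_normr => /orP[h|h]; apply/orP; [left|right]; lra.
Qed.

(** * Choice of the block length, and the embedding of edge sequences by blocks *)

Lemma exprn_eventually_le {R : realType} (q eps : R) :
  0 <= q < 1 -> 0 < eps -> exists k0, forall k, (k0 <= k)%N -> q ^+ k <= eps.
Proof.
move=> /andP[q0 q1] eps0.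
have cq : (fun n : nat => q ^+ n) @ \oo --> (0 : R).
  by apply: cvg_expr; rewrite ger0_norm.
have /cvgrPdist_le /(_ _ eps0) [k0 _ h] := cq.
exists k0 => k kk0; have := h k kk0.
by rewrite /= sub0r normrN ger0_norm // exprn_ge0.
Qed.

(** With b = alpha^K, a count N <= C l^(-K) must fit into M^m, where M is about 1/(3b). Since
    alpha^m / l < 1, its K-th power eventually drops below 1 / (C 6^m), which says C l^(-K) <=
    (6b)^(-m) <= M^m. *)
Lemma block_length_exists {R : realType} (alpha l C : R) (m : nat) :
  0 < alpha < 1 -> alpha ^+ m < l -> 0 < C ->
  exists K M : nat, [/\ (0 < K)%N, (0 < M)%N, alpha ^+ K <= 6^-1,
    M%:R * alpha ^+ K <= 3^-1 &
    forall N : nat, N%:R * l ^+ K <= C -> (N <= M ^ m)%N].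
Proof.
move=> /andP[a0 a1] ml C0.
have mu0 : 0 < alpha ^+ m by rewrite exprn_gt0.
have l0 : 0 < l := lt_trans mu0 ml.
have q01 : 0 <= alpha ^+ m / l < 1.
  by rewrite divr_ge0 ?(ltW mu0) ?(ltW l0) //= ltr_pdivrMr // mul1r.
have eps0 : 0 < (C * 6 ^+ m)^-1 by rewrite invr_gt0 mulr_gt0 // exprn_gt0.
have [k1 h1] := exprn_eventually_le _ _ q01 eps0.
have a01 : 0 <= alpha < 1 by rewrite ltW.
have [k2 h2] := exprn_eventually_le alpha 6^-1 a01 ltac:(by rewrite invr_gt0).
pose K := (k1 + k2).+1.
have {}h1 := h1 K (leqW (leq_addr k2 k1)).
have {}h2 := h2 K (leqW (leq_addl k1 k2)).
move: h1 h2; set b := alpha ^+ K => h1 h2.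
have b0 : 0 < b by rewrite exprn_gt0.
pose z : R := (3 * b)^-1.
have z0 : 0 <= z by rewrite invr_ge0 mulr_ge0 // ltW.
have zb : z * b = 3^-1 by rewrite /z; field; rewrite gt_eqF.
have /andP[Mz zM] := truncn_itv z0.
set M := Num.truncn z in Mz zM.
(* As b <= 1/6, z = 1/(3b) is at least 2, so truncating it loses at most half of it. *)
have zM' : (6 * b)^-1 <= M%:R.
  have e : (6 * b)^-1 = z / 2 by rewrite /z; field; rewrite gt_eqF.
  rewrite e; have z2 : 2 <= z by rewrite -(ler_pM2r b0) zb; lra.
  move: zM; rewrite -natr1; lra.
exists K, M; split => //.
- by rewrite -(ltr_nat R); apply: lt_le_trans zM'; rewrite invr_gt0 mulr_gt0.
- by rewrite -zb ler_wpM2r // ltW.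
move=> N NC; rewrite -(ler_nat R) natrX.
apply: le_trans (lerXn2r m _ _ zM'); rewrite
  ?nnegrE ?invr_ge0 ?mulr_ge0 ?(ltW b0) //.
have lK : 0 < l ^+ K by rewrite exprn_gt0.
have bm : 0 < b ^+ m by rewrite exprn_gt0.
have s6 : (0 : R) < 6 ^+ m by rewrite exprn_gt0.
rewrite -(ler_pM2r lK); apply: le_trans NC _.
rewrite -(ler_pM2r (mulr_gt0 s6 bm)).
rewrite exprVn exprMn.
have -> : (6 ^+ m * b ^+ m)^-1 * l ^+ K * (6 ^+ m * b ^+ m) = l ^+ K.
  by field; rewrite !gt_eqF.
move: h1; rewrite expr_div_n -exprM mulnC exprM -/b ler_pdivrMr //.
move=> h1; have C60 : 0 < C * 6 ^+ m by rewrite mulr_gt0.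
rewrite mulrA -(ler_pM2l (_ : 0 < (C * 6 ^+ m)^-1)) ?invr_gt0 //.
by rewrite mulKf // gt_eqF.
Qed.

Lemma injection_of_card_le (A T : finType) (D : {set A}) (t0 : T) :
  (#|D| <= #|T|)%N -> exists f : A -> T, {in D &, injective f}.
Proof.
move=> DT; exists (fun x => nth t0 (enum T) (index x (enum D))) => x y xD yD.
have lt z : z \in D -> (index z (enum D) < size (enum T))%N.
  by move=> zD; rewrite -cardE (leq_trans _ DT) // cardE index_mem mem_enum.
move=> /eqP; rewrite nth_uniq ?enum_uniq ?lt // => /eqP.
move=> e; rewrite -[LHS](@nth_index _ x x (enum D)) ?mem_enum // e.
by rewrite nth_index ?mem_enum.
Qed.

Definition block {E : finType} (K : nat) (e : nat -> E) (j : nat) : K.-tuple E :=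
  [tuple e (j * K + i)%N | i < K].

Lemma block_live {V E : finType} {s r : E -> V} {e : nat -> E} (K j : nat) :
  edge_path s r e -> block K e j \in live_words s r K.
Proof.
move=> pe; rewrite inE; apply/asboolP; exists (fun i => e (j * K + i)%N).
  exact: edge_path_shift.
by rewrite size_tuple /= /mkseq -val_enum_ord -map_comp.
Qed.

(** Block j of a path is coded by a grid point whose i-th coordinate is digit j of the i-th
    expansion. If the first distinct edge has index k, the blocks before k / K agree and block k / K
    differs. The lower bound comes from a single coordinate where the two grid points differ. *)
Lemma block_embedding {R : realType} {V E : finType} (s r : E -> V)
    (m K M : nat) (b : R) :
  (0 < K)%N -> (0 < M)%N -> 0 < b -> b <= 6^-1 -> M%:R * b <= 3^-1 ->
  (#|live_words s r K| <= M ^ m)%N ->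
  exists F : (nat -> E) -> 'rV[R]_m, forall e e' k,
    edge_path s r e -> edge_path s r e' ->
    (forall i, (i < k)%N -> e i = e' i) -> e k <> e' k ->
    b ^+ (k %/ K) / 2 <= euclidean_norm (F e - F e')
                      <= m%:R * (M%:R * b ^+ (k %/ K) / (1 - b)).
Proof.
move=> K0 M0 b0 b6 Mb card.
have [f finj] : exists f : K.-tuple E -> {ffun 'I_m -> 'I_M},
    {in live_words s r K &, injective f}.
  apply: injection_of_card_le; first exact: [ffun=> Ordinal M0].
  by rewrite card_ffun !card_ord.
pose dg e i j : R := (f (block K e j) i)%:R.
have dgB e i j : 0 <= dg e i j <= M%:R.
  by rewrite ler0n ler_nat ltnW.
exists (fun e => \row_i digit_value b (dg e i)) => e e' k pe pe' ee' ek.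
have deq i j : (j < k %/ K)%N -> dg e i j = dg e' i j.
  move=> jk; rewrite /dg; congr (_ (f _ i))%:R; apply/eq_from_tnth => c.
  rewrite !tnth_mktuple ee' //.
  (* All positions j K + c of block j, with c < K, precede (k / K) K, hence k. *)
  have := leq_mul2r K j.+1 (k %/ K); rewrite jk orbT => h.
  have := leq_divM k K; have := ltn_ord c; lia.
apply/andP; split; last first.
  apply: euclidean_norm_le => [|i].
    by rewrite divr_ge0 ?mulr_ge0 ?exprn_ge0 ?(ltW b0) //; lra.
  rewrite !mxE; apply: digit_value_upper => //; last exact: deq.
  by rewrite b0; lra.
have : f (block K e (k %/ K)) != f (block K e' (k %/ K)).
  apply/eqP => /finj; rewrite !block_live // => /(_ isT isT).
  move/(congr1 (fun t => tnth t (Ordinal (ltn_pmod k K0)))).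
  by rewrite !tnth_mktuple /= -divn_eq.
move/eqP => fne.
have /existsNP [i /eqP fi] := fun h => fne (proj1 (ffunP _ _) h).
apply: le_trans (euclidean_norm_ge _ i); rewrite !mxE.
apply: (@digit_value_lower _ _ M%:R) => //; first exact: deq.
rewrite /dg; move: fi; rewrite -val_eqE /=.
move: (nat_of_ord _) (nat_of_ord _) => p q pq.
rewrite ler_normr opprB !lerBrDl !natr1 !ler_nat; lia.
Qed.

(** * Infinite paths as edge sequences, and the comparison of rho with powers of alpha *)

(* The edge of E_0 is dropped: it is determined by the next one. *)
Definition edges {V E : finType} {s r : E -> V} (x : infinite_path s r) (i : nat)
  : E := set_val x i.+1.

Definition root_vertex {V E : finType} {s r : E -> V} (x : infinite_path s r)
  : V := set_val x 0.

Section PathEdges.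
Context {V E : finType} {s r : E -> V}.
Implicit Types x y : infinite_path s r.

Lemma root_edges x : root_vertex x = s (edges x 0).
Proof. exact: (set_valP x 0%N). Qed.

Lemma edges_path x : edge_path s r (edges x).
Proof. by move=> n; exact: (set_valP x n.+1). Qed.

Lemma edges_inj x y : edges x =1 edges y -> x = y.
Proof.
move=> xy; apply: val_inj; apply: functional_extensionality_dep => -[|n].
  by have := root_edges x; rewrite xy -root_edges.
exact: xy.
Qed.

Lemma edges_surj (e : nat -> E) : edge_path s r e -> exists x, edges x = e.
Proof.
move=> pe.
pose u : edge_sequence V E := fun n =>
  match n return discrete_topology (level_edge V E n) with
  | 0 => s (e 0%N) | i.+1 => e i end.
have pu : is_infinite_path s r u by case=> [|n] //; exact: pe.
by exists (SigSub (mem_set pu)).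
Qed.

Lemma first_difference x y : x <> y ->
  exists k, (forall i, (i < k)%N -> edges x i = edges y i) /\
            edges x k <> edges y k.
Proof.
move=> xy.
have /existsNP [k0 /eqP k0P] : ~ (edges x =1 edges y) by move=> /edges_inj.
have [k kP kmin] := ex_minnP (ex_intro (fun k => edges x k != edges y k) k0 k0P).
exists k; split; last exact/eqP.
move=> i ik; apply/eqP; apply: contraTT ik => /kmin; by rewrite leqNgt.
Qed.

Lemma is_walk_mkseq (v : V) (e : nat -> E) (n : nat) :
  v = s (e 0%N) -> edge_path s r e -> is_walk s r v (mkseq e n).
Proof.
elim: n v e => [//|n IH] v e ve pe.
have -> : mkseq e n.+1 = e 0%N :: mkseq (fun i => e i.+1) n.
  by rewrite /mkseq /= (iotaDl 1 0) -map_comp.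
rewrite /= -ve eqxx /=; apply: IH; first exact: pe.
by move=> i; exact: pe.
Qed.

Lemma truncation_finite x n : finite_path s r (truncation x n).
Proof.
by case: n => [//|n]; apply: is_walk_mkseq; [exact: root_edges|exact: edges_path].
Qed.

Lemma path_length_truncation x n : path_length (truncation x n) = n.
Proof. by case: n => //= n; rewrite size_mkseq. Qed.

Lemma longest_common_prefix_None x y : root_vertex x <> root_vertex y ->
  longest_common_prefix x y None.
Proof.
move=> xy; split=> // -[[v p]|] //=; rewrite /is_prefix /= => -[vx _] [vy _].
by case: xy; rewrite /root_vertex -vx -vy.
Qed.

(** The edge of index k sits at level k + 1, so the root edge and the k common edges make a common
    prefix of length k + 1. *)
Lemma longest_common_prefix_truncation x y k : root_vertex x = root_vertex y ->
  (forall i, (i < k)%N -> edges x i = edges y i) -> edges x k <> edges y k ->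
  longest_common_prefix x y (truncation x k.+1).
Proof.
move=> xy eqk nek.
have txy : truncation x k.+1 = truncation y k.+1.
  rewrite /truncation; congr (Some (_, _)); first exact: xy.
  apply: (@eq_from_nth _ (edges x 0)); rewrite !size_mkseq // => i ik.
  by rewrite !nth_mkseq //; exact: eqk.
split; rewrite /is_prefix path_length_truncation //.
move=> h hx hy; rewrite leqNgt; apply/negP => lt; apply: nek.
move: hy; rewrite hx path_length_truncation.
case: (path_length h) lt => // n; rewrite ltnS => kn.
move=> [_ /(congr1 (fun q => nth (edges x 0) q k))].
by rewrite !nth_mkseq.
Qed.

(** The constants are the infimum and the supremum of the weights [a]. With equal roots the common
    prefix has length k + 1; with distinct roots it is empty and k = 0, because the first edge
    determines the root. The exponents k + 1 below and k above cover both cases. *)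
Lemma rho_bounds {R : realType} {alpha : R} {rho : infinite_path s r -> _ -> R} :
  self_similar_ultrametric alpha rho ->
  exists c1 c2, [/\ 0 < c1, 0 < c2 & forall x y k,
    (forall i, (i < k)%N -> edges x i = edges y i) -> edges x k <> edges y k ->
    c1 * alpha ^+ k.+1 <= rho x y <= c2 * alpha ^+ k].
Proof.
move=> [_ /andP[a0 a1] [a [apos ainf asup _ rhoE]]].
set A := [set _ | g in _] in ainf asup.
have A0 g : finite_path s r g -> A (a g)%:E by move=> fg; exists g.
have FN : finite_path s r None by [].
have infle g : finite_path s r g -> (ereal_inf A <= (a g)%:E)%E.
  by move=> fg; apply: ereal_inf_lbound; exact: A0.
have suple g : finite_path s r g -> ((a g)%:E <= ereal_sup A)%E.
  by move=> fg; apply: ereal_sup_ubound; exact: A0.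
have finf : ereal_inf A \is a fin_num.
  rewrite ge0_fin_numE ?(ltW ainf) //; apply: le_lt_trans (infle _ FN) _.
  exact: ltry.
have fsup : ereal_sup A \is a fin_num.
  rewrite ge0_fin_numE //; apply: le_trans (suple _ FN).
  by rewrite lee_fin ltW // apos.
exists (fine (ereal_inf A)), (fine (ereal_sup A)).
have c1g g : finite_path s r g -> fine (ereal_inf A) <= a g.
  by move=> fg; rewrite -lee_fin fineK // infle.
have c2g g : finite_path s r g -> a g <= fine (ereal_sup A).
  by move=> fg; rewrite -lee_fin fineK // suple.
have c1p : 0 < fine (ereal_inf A) by rewrite -lte_fin fineK.
have c2p : 0 < fine (ereal_sup A) by apply: lt_le_trans (c2g _ FN); exact: apos.
split=> // x y k eqk nek.
have xney : x <> y by move=> exy; apply: nek; rewrite exy.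
have ak n : 0 <= alpha ^+ n by rewrite exprn_ge0 // ltW.
have aS n : alpha ^+ n.+1 <= alpha ^+ n by rewrite ler_wiXn2l // ltW.
have [rxy|rxy] := pselect (root_vertex x = root_vertex y).
  rewrite (rhoE _ _ _ xney (longest_common_prefix_truncation _ _ _ rxy eqk nek)).
  have fg := truncation_finite x k.+1.
  rewrite path_length_truncation ler_wpM2r ?ak ?c1g //=.
  by rewrite ler_pM ?ak ?aS ?c2g // ltW // apos.
rewrite (rhoE _ _ _ xney (longest_common_prefix_None _ _ rxy)) /=.
have k0 : k = 0%N.
  case: k eqk {nek} => // k eqk; exfalso; apply: rxy.
  by rewrite !root_edges eqk.
rewrite k0 expr0 !mulr1 c2g // andbT expr1 (le_trans _ (c1g _ FN)) //.
by rewrite ler_piMr // ltW.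
Qed.

End PathEdges.

(** * Diameters, gauges and sets of Hausdorff measure zero *)

Section HausdorffFacts.
Context {R : realType} {T : Type} {d : T -> T -> R}.
Local Open Scope ereal_scope.

Lemma gauge_ge0 t (A : set T) : 0 <= gauge d t A.
Proof. by rewrite /gauge; case: ifP => // _; exact: poweR_ge0. Qed.

Lemma hausdorff_content_ge0 delta t (A : set T) :
  0 <= hausdorff_content d delta t A.
Proof.
apply: le_ereal_inf_tmp => _ [U _ <-].
by apply: nneseries_ge0 => i _ _; exact: gauge_ge0.
Qed.

Lemma hausdorff_measure0_cover t (A : set T) delta eps :
  hausdorff_measure d t A = 0 -> (0 < delta)%R -> 0 < eps ->
  exists U : nat -> set T, [/\ A `<=` \bigcup_i U i,
    forall i, diameter d (U i) <= delta%:E &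
    \sum_(0 <= i <oo) gauge d t (U i) < eps].
Proof.
move=> H0 delta0 eps0.
have : hausdorff_content d delta t A < eps.
  by apply: le_lt_trans eps0; rewrite -H0; apply: ereal_sup_ubound; exists delta.
by move=> /ereal_inf_lt [_ [U [AU dU] <-] lt]; exists U.
Qed.

(** For t = 0 every nonempty covering set has gauge 1, so no cover of a nonempty set has total below
    1. Positivity of t is what makes alpha^t smaller than 1. *)
Lemma hausdorff_measure0_gt0 t (A : set T) : A !=set0 -> (0 <= t)%R ->
  hausdorff_measure d t A = 0 -> (0 < t)%R.
Proof.
move=> [x Ax] t0 H0; rewrite lt_neqAle t0 andbT; apply/eqP => t0'.
have [U [AU _]] := hausdorff_measure0_cover _ _ _ _ H0 ltr01 lte01.
have [i _ Uix] := AU x Ax.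
apply/negP; rewrite -leNgt.
apply: le_trans (@nneseries_lim_ge _ _ xpredT 0 i.+1 _); last first.
  by move=> n _ _; exact: gauge_ge0.
rewrite big_nat_recr //= -[leLHS]add0e leeD //.
  by apply: sume_ge0 => n _; exact: gauge_ge0.
rewrite /gauge ifF -?t0' ?poweRe0 //.
by apply/negP => /eqP U0; move: Uix; rewrite U0.
Qed.

Lemma le_diameter (A : set T) x y : A x -> A y -> (d x y)%:E <= diameter d A.
Proof.
move=> Ax Ay; rewrite /diameter le_max; apply/orP; right.
by apply: ereal_sup_ubound; exists x => //; exists y.
Qed.

Lemma diameter_le (A : set T) (D : R) : (0 <= D)%R ->
  (forall x y, A x -> A y -> (d x y <= D)%R) -> diameter d A <= D%:E.
Proof.
move=> D0 AD; rewrite /diameter ge_max lee_fin D0 /=.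
by apply: ge_ereal_sup => _ [x Ax [y Ay <-]]; rewrite lee_fin AD.
Qed.

Lemma gauge_le (A : set T) t (D : R) : (0 <= t)%R -> (0 <= D)%R ->
  diameter d A <= D%:E -> gauge d t A <= (D `^ t)%:E.
Proof.
move=> t0 D0 AD; rewrite /gauge; case: ifP => _; first by rewrite lee_fin powR_ge0.
rewrite -poweR_EFin; apply: gt0_ler_poweR => //.
- by rewrite in_itv /= leey andbT /diameter le_max lexx.
- by rewrite in_itv /= leey lee_fin D0.
Qed.

Lemma gauge_fin (A : set T) t (D : R) : A !=set0 -> diameter d A <= D%:E ->
  exists2 D' : R, (0 <= D')%R & 
    diameter d A = D'%:E /\ gauge d t A = (D' `^ t)%:E.
Proof.
move=> /set0P A0 AD.
have d0 : 0 <= diameter d A by rewrite /diameter le_max lexx.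
have dfin : diameter d A \is a fin_num.
  by rewrite ge0_fin_numE // (le_lt_trans AD) // ltry.
exists (fine (diameter d A)); first exact: fine_ge0.
by rewrite fineK // /gauge (negbTE A0) -poweR_EFin fineK.
Qed.

End HausdorffFacts.

(** * From covers of small total gauge to prefix covers, and finiteness of the dimension *)

Lemma half_powers_sum {R : realType} (N : nat) :
  \sum_(0 <= i < N) (2^-1 : R) ^+ i.+2 <= 2^-1.
Proof.
suff -> : \sum_(0 <= i < N) (2^-1 : R) ^+ i.+2 = 2^-1 - 2^-1 ^+ N.+1.
  by rewrite gerBl exprn_ge0.
elim: N => [|N IH]; first by rewrite big_geq // expr1 subrr.
by rewrite big_nat_recr //= IH !exprS; field.
Qed.

Section Covers.
Context {R : realType} {V E : finType} {s r : E -> V} {alpha c1 c2 : R}.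
Context {rho : infinite_path s r -> infinite_path s r -> R}.
Context (a0 : 0 < alpha) (a1 : alpha < 1) (c1p : 0 < c1) (c2p : 0 < c2).
Context (rho_refl : forall x, rho x x = 0).
Context (bounds : forall x y k,
  (forall i, (i < k)%N -> edges x i = edges y i) -> edges x k <> edges y k ->
  c1 * alpha ^+ k.+1 <= rho x y <= c2 * alpha ^+ k).

Lemma near_edges (x : infinite_path s r) (n : nat) :
  \forall y \near x, forall i, (i < n)%N -> edges y i = edges x i.
Proof.
have FN : Filter (nbhs x) := nbhs_filter x.
elim: n => [|n IH]; first by apply: filterE.
have cont : continuous
    (fun y : infinite_path s r =>
       (set_val y n.+1 : discrete_topology (level_edge V E n.+1))).
  move=> y; apply: (@continuous_comp _ _ _ (@set_val _ (is_infinite_path s r))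
    (fun u : edge_sequence V E => u n.+1)).
    exact: initial_continuous.
  exact: (@proj_continuous nat (fun n => discrete_topology (level_edge V E n))).
have eqn : \forall y \near x, edges y n = edges x n.
  apply: (cont x [set e | e = edges x n]).
  by apply: open_nbhs_nbhs; split; [exact: discrete_open|].
apply: filterS2 IH eqn => y IH eqn i; rewrite ltnS leq_eqVlt.
by move=> /orP[/eqP ->//|]; exact: IH.
Qed.

(** For D > 0, take the least n with c1 alpha^(n+1) <= D. Two points of [A] cannot differ before
    index n, as they would be more than D apart; the weight in the last clause is (c1 alpha^(n+1))^t
    <= D^t. The bound D < c1 alpha forces n > 0. *)
Lemma short_word (A : set (infinite_path s r)) (t D eta : R) :
  0 < t -> 0 < eta -> A !=set0 -> 0 <= D -> D < c1 * alpha ->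
  (forall x y, A x -> A y -> rho x y <= D) ->
  exists w : seq E, [/\ (0 < size w)%N,
    forall x, A x -> w = mkseq (edges x) (size w) &
    (alpha `^ t) ^+ size w * (c1 * alpha) `^ t <= D `^ t + eta].
Proof.
move=> t0 eta0 [x Ax] D0 Dlt AD.
have l0 : 0 < alpha `^ t by rewrite powR_gt0.
have l1 : alpha `^ t < 1.
  by have := gt0_ltr_powR t0 _ _ a1; rewrite powR1; apply; rewrite nnegrE ltW.
have c0 : 0 < (c1 * alpha) `^ t by rewrite powR_gt0 // mulr_gt0.
suff [n [n0 agree le]] : exists n, [/\ (0 < n)%N,
    forall k, c1 * alpha ^+ k.+1 <= D -> (n <= k)%N &
    (alpha `^ t) ^+ n * (c1 * alpha) `^ t <= D `^ t + eta].
  exists (mkseq (edges x) n); rewrite size_mkseq; split=> // y Ay.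
  apply: (@eq_from_nth _ (edges x 0)); rewrite !size_mkseq // => i lt.
  rewrite !nth_mkseq //; have [-> //|xy] := pselect (x = y).
  have [k [eqk nek]] := first_difference x y xy.
  have /andP[lo _] := bounds _ _ _ eqk nek.
  by apply: eqk; apply: leq_trans lt (agree _ (le_trans lo (AD _ _ Ax Ay))).
(* A singleton has diameter 0 and admits arbitrarily long common words; eta
   absorbs their contribution. *)
move: D0; rewrite le_eqVlt => /orP[/eqP D0|D0].
  have [k0 h] := exprn_eventually_le (alpha `^ t) (eta / (c1 * alpha) `^ t)
    ltac:(by rewrite ltW) (divr_gt0 eta0 c0).
  exists k0.+1; split=> //.
    move=> k; rewrite -D0 leNgt mulr_gt0 ?exprn_gt0 //.
  by rewrite -ler_pdivlMr // (le_trans (h _ (leqnSn _))) // ler_wpM2r ?invr_ge0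
    ?(ltW c0) // lerDr powR_ge0.
have [k0 h] := exprn_eventually_le alpha (D / (c1 * alpha))
    ltac:(by rewrite ltW) (divr_gt0 D0 (mulr_gt0 c1p a0)).
have ex : exists n, c1 * alpha ^+ n.+1 <= D.
  exists k0; rewrite exprS mulrA mulrC -ler_pdivlMr ?mulr_gt0 //; exact: h.
have [n nD nmin] := ex_minnP ex.
exists n; split=> //.
  by case: n nD {nmin} => // ; rewrite expr1 leNgt Dlt.
have -> : (alpha `^ t) ^+ n = (alpha ^+ n) `^ t.
  by rewrite -powR_mulrn ?powR_ge0 // powRAC powR_mulrn // ltW.
rewrite -powRM ?exprn_ge0 ?mulr_ge0 ?(ltW a0) ?(ltW c1p) //.
apply: (@le_trans _ _ (D `^ t)); last by rewrite lerDl ltW.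
apply: ge0_ler_powR; rewrite
  ?nnegrE ?mulr_ge0 ?exprn_ge0 ?(ltW a0) ?(ltW c1p) ?(ltW D0) ?(ltW t0) //.
by have := nD; rewrite exprS mulrA mulrC.
Qed.

(** Each nonempty set of a fine cover is enlarged to the cylinder of the word given by [short_word],
    and compactness keeps finitely many of these cylinders. *)
Lemma prefix_cover_of_hausdorff0 (t : R) :
  compact [set: infinite_path s r] -> 0 < t ->
  hausdorff_measure rho t [set: infinite_path s r] = 0%E ->
  exists G, [/\ prefix_cover s r G, forall w, w \in G -> (0 < size w)%N &
    \sum_(w <- G) (alpha `^ t) ^+ size w <= 1].
Proof.
move=> cpt t0 H0.
have l0 : 0 < alpha `^ t by rewrite powR_gt0.
pose c := (c1 * alpha) `^ t.
have ca0 : 0 < c1 * alpha by rewrite mulr_gt0.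
have c0 : 0 < c by rewrite powR_gt0.
(* Halving c1 alpha gives the strict bound required by [short_word]. Of the total budget c, one half
   goes to the gauges and the other to the errors c / 2^(i+2). *)
have delta0 : 0 < c1 * alpha / 2 by rewrite divr_gt0.
have eps0 : (0 < (c / 2)%:E)%E by rewrite lte_fin divr_gt0.
have [U [covU diamU sumU]] := hausdorff_measure0_cover _ _ _ _ H0 delta0 eps0.
have wP i : exists w : seq E, U i !=set0 -> [/\ (0 < size w)%N,
    forall x, U i x -> w = mkseq (edges x) (size w) &
    ((alpha `^ t) ^+ size w * c)%:E <= gauge rho t (U i) + (c * 2^-1 ^+ i.+2)%:E]%E.
  (* For empty [U i] any word will do: the filter [B] discards it below. *)
  have [Ui0|] := pselect (U i !=set0); last by exists [::].
  have [D D0 [diamD gD]] := gauge_fin (U i) t _ Ui0 (diamU i).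
  have DU x y : U i x -> U i y -> rho x y <= D.
    by move=> Ux Uy; rewrite -lee_fin -diamD; exact: le_diameter.
  have Dlt : D < c1 * alpha.
    by have := diamU i; rewrite diamD lee_fin; move: ca0; lra.
  have eta0 : 0 < c * 2^-1 ^+ i.+2 by rewrite mulr_gt0 // exprn_gt0 // invr_gt0.
  have [w [w0 wU wle]] := short_word _ _ _ _ t0 eta0 Ui0 D0 Dlt DU.
  by exists w => _; split=> //; rewrite gD -EFinD lee_fin.
have [w {}wP] := choice wP.
have /compact_near_coveringP cov := cpt.
pose P N (x : infinite_path s r) := exists i, [/\ (i < N)%N, U i !=set0 &
  w i = mkseq (edges x) (size (w i))].
(* The [U i] need not be open; compactness is applied to the cylinders of the [w i], which are
   neighbourhoods of their points by [near_edges]. *)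
have [N _ NP] : \forall N \near \oo, [set: infinite_path s r] `<=` P N.
  apply: cov => x _.
  have [i _ Uix] := covU x I.
  have Ui0 : U i !=set0 by exists x.
  have [_ /(_ x Uix) wx _] := wP i Ui0.
  exists ([set y | forall j, (j < size (w i))%N -> edges y j = edges x j],
          [set N | (i < N)%N]).
    by split; [exact: near_edges | exists i.+1].
  move=> [y N] [/= agree iN]; exists i; split=> //.
  rewrite [LHS]wx; apply: (@eq_from_nth _ (edges x 0)); rewrite !size_mkseq // => j lt.
  by rewrite !nth_mkseq // agree.
have {}NP := NP N (leqnn N).
pose B i := `[< U i !=set0 >].
exists [seq w i | i <- index_iota 0 N & B i]; split.
- move=> e pe; have [x xe] := edges_surj e pe.
  have [i [iN Ui0 wi]] := NP x I.
  exists (w i); last by rewrite -xe.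
  apply/mapP; exists i => //; rewrite mem_filter mem_index_iota iN !andbT.
  exact/asboolP.
- move=> _ /mapP [i + ->]; rewrite mem_filter => /andP[/asboolP Ui0 _].
  by have [] := wP i Ui0.
rewrite big_map big_filter -(ler_pM2r c0) mul1r mulr_suml -lee_fin -sumEFin.
apply: (@le_trans _ _ (\sum_(0 <= i < N)
    (gauge rho t (U i) + (c * 2^-1 ^+ i.+2)%:E))%E).
  rewrite big_mkcond /=; apply: lee_sum => i _; case: ifP => [/asboolP Ui0|_].
    by have [] := wP i Ui0.
  rewrite adde_ge0 ?gauge_ge0 // lee_fin mulr_ge0 ?(ltW c0) // exprn_ge0 //.
rewrite big_split /= sumEFin -mulr_sumr.
have -> : c%:E = ((c / 2)%:E + (c * 2^-1)%:E)%E by rewrite -EFinD; congr EFin; field.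
rewrite leeD //; last by rewrite lee_fin ler_wpM2l ?(ltW c0) ?half_powers_sum.
apply: le_trans (ltW sumU).
by apply: (@nneseries_lim_ge _ _ xpredT) => i _ _; exact: gauge_ge0.
Qed.

(** This makes the dimension finite. The cylinders of length n number at most |E|^n and have
    diameter at most c2 alpha^n, so for |E| alpha^m <= 1/2 their total gauge is at most c2^m /
    2^n. *)
Lemma hausdorff_measure_eq0 :
  exists m : nat, hausdorff_measure rho m%:R [set: infinite_path s r] = 0%E.
Proof.
pose p : R := #|E|%:R.
have a01 : 0 <= alpha < 1 by rewrite ltW.
have p1 : 0 < p + 1 by rewrite ltr_wpDl.
(* Using p + 1 keeps the denominator positive even when [E] is empty. *)
have [m hm] := exprn_eventually_le alpha (2 * (p + 1))^-1 a01
  ltac:(by rewrite invr_gt0 mulr_gt0).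
have {}hm : p * alpha ^+ m <= 2^-1.
  have := hm m (leqnn m).
  rewrite -[_^-1]div1r ler_pdivlMr ?mulr_gt0 // => h.
  have : 0 <= alpha ^+ m by rewrite exprn_ge0 // ltW.
  by have : 0 <= p by []; nra.
exists m; apply/eqP; rewrite eq_le; apply/andP; split; last first.
  apply: (@le_trans _ _ (hausdorff_content rho 1 m%:R setT)).
    exact: hausdorff_content_ge0.
  by apply: ereal_sup_ubound; exists 1 => //=.
apply: ge_ereal_sup => _ [delta /= delta0 <-].
apply/lee_addgt0Pr => eps eps0; rewrite add0e.
have cm0 : 0 < c2 ^+ m by rewrite exprn_gt0.
have [n1 h1] := exprn_eventually_le alpha (delta / c2) a01 (divr_gt0 delta0 c2p).
have [n2 h2] := exprn_eventually_le 2^-1 (eps / c2 ^+ m)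
  ltac:(lra) (divr_gt0 eps0 cm0).
pose n := (n1 + n2)%N.
have {}h1 : c2 * alpha ^+ n <= delta.
  by rewrite mulrC -ler_pdivlMr // h1 // leq_addr.
have {}h2 : c2 ^+ m * 2^-1 ^+ n <= eps.
  by rewrite mulrC -ler_pdivlMr // h2 // leq_addl.
pose blk (x : infinite_path s r) : n.-tuple E := [tuple edges x i | i < n].
(* Cylinders are indexed by the rank of their word; indices from |E|^n on give empty sets, of gauge
   0. *)
pose U i : set (infinite_path s r) := [set x | enum_rank (blk x) = i :> nat].
have D0 : 0 <= c2 * alpha ^+ n by rewrite mulr_ge0 ?exprn_ge0 // ltW.
have diamU i : (diameter rho (U i) <= (c2 * alpha ^+ n)%:E)%E.
  apply: diameter_le => // x y Ux Uy.
  have [->|xy] := pselect (x = y); first by rewrite rho_refl.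
  have bxy : blk x = blk y.
    by apply: enum_rank_inj; apply: val_inj; rewrite /= [LHS]Ux Uy.
  have [k [eqk nek]] := first_difference x y xy.
  have /andP[_ hi] := bounds _ _ _ eqk nek.
  apply: le_trans hi _; rewrite ler_wpM2l ?(ltW c2p) //.
  rewrite ler_wiXn2l ?(ltW a0) ?(ltW a1) //.
  rewrite leqNgt; apply/negP => kn; apply: nek.
  by have /(congr1 (fun u => tnth u (Ordinal kn))) := bxy; rewrite !tnth_mktuple.
pose b : R := (c2 * alpha ^+ n) ^+ m.
have b0 : 0 <= b by rewrite exprn_ge0.
have gU i : (gauge rho m%:R (U i) <= if (i < #|{: n.-tuple E}|)%N then b%:E else 0)%E.
  case: ifP => lt.
    by rewrite /b -powR_mulrn //; exact: gauge_le.
  rewrite /gauge ifT //; apply/eqP; rewrite -subset0 => x Ux.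
  by have := ltn_ord (enum_rank (blk x)); rewrite Ux lt.
apply: ge_ereal_inf; exists (\sum_(0 <= i <oo) gauge rho m%:R (U i))%E.
  exists U => //; split; first by move=> x _; exists (enum_rank (blk x)).
  by move=> i; apply: le_trans (diamU i) _; rewrite lee_fin.
apply: lime_le; first by apply: is_cvg_nneseries => i _ _; exact: gauge_ge0.
apply: nearW => N.
apply: (@le_trans _ _ ((minn N #|{: n.-tuple E}|)%:R * b)%:E).
  elim: N => [|N IH]; first by rewrite big_geq // min0n mul0r.
  rewrite big_nat_recr //=; apply: le_trans (leeD IH (gU N)) _.
  case: ltnP => h.
    by rewrite (minn_idPl h) -EFinD lee_fin -natr1 mulrDl mul1r.
  by rewrite adde0 (minn_idPr (leqW h)).
rewrite lee_fin; apply: le_trans h2.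
apply: (@le_trans _ _ (#|{: n.-tuple E}|%:R * b)).
  by rewrite ler_wpM2r // ler_nat geq_minr.
rewrite card_tuple natrX -/p /b exprMn mulrCA ler_wpM2l ?(ltW cm0) //.
by rewrite -exprM mulnC exprM -exprMn lerXn2r ?nnegrE ?mulr_ge0 ?exprn_ge0
  ?(ltW a0).
Qed.

End Covers.

(** * Assembly of the bi-Lipschitz embedding *)

Lemma powR_gt_exprn {R : realType} (a t : R) (m : nat) :
  0 < a < 1 -> t < m%:R -> a ^+ m < a `^ t.
Proof.
move=> /andP[a0 a1] tm.
rewrite -powR_mulrn ?(ltW a0) // /powR gt_eqF // ltr_expR.
by rewrite ltr_nM2r // ln_lt0 // a0.
Qed.

Theorem theorem3p3 (R : realType) (V E : finType) (s r : E -> V) (alpha : R)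
    (rho : infinite_path s r -> infinite_path s r -> R) :
  cantor_set (infinite_path s r) ->
  self_similar_ultrametric alpha rho ->
  hausdorff_dim rho \is a fin_num /\
  exists (F : infinite_path s r ->
              'rV[R]_((Num.truncn (fine (hausdorff_dim rho))).+1))
         (c_minus c_plus : R),
    [/\ 0 < c_minus, c_minus <= c_plus &
        forall x y, c_minus * rho x y <= euclidean_norm (F x - F y)
                      <= c_plus * rho x y].
Proof.
move=> [ne cpt _ _] ssu.
have [c1 [c2 [c1p c2p bounds]]] := rho_bounds ssu.
have [[_ rho0 _ _] a01 _] := ssu.
have /andP[a0 a1] := a01.
have rho_refl x : rho x x = 0 by apply/rho0.
set S := [set t%:E | t in [set t : R | 0 <= t /\
  hausdorff_measure rho t [set: infinite_path s r] = 0%E]].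
have dimE : hausdorff_dim rho = ereal_inf S by [].
have [m0 Hm0] := hausdorff_measure_eq0 a0 a1 c2p rho_refl bounds.
have dim_ge0 : (0 <= hausdorff_dim rho)%E.
  by rewrite dimE; apply: le_ereal_inf_tmp => _ [t [t0 _] <-]; rewrite lee_fin.
have dim_fin : hausdorff_dim rho \is a fin_num.
  rewrite ge0_fin_numE // dimE; apply: (@le_lt_trans _ _ (m0%:R)%:E).
    by apply: ereal_inf_lbound; exists m0%:R.
  exact: ltry.
split=> //; move: (fine_ge0 dim_ge0) => d0.
have /andP[_ dm] := truncn_itv d0.
set m := (Num.truncn _).+1 in dm *.
(* The integer part plus one exceeds the dimension, so the infimum defining the dimension leaves
   room for an admissible t < m. *)
have [t [t0 Ht] tm] : exists2 t : R, 0 <= t /\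
    hausdorff_measure rho t [set: infinite_path s r] = 0%E & t < m%:R.
  have : (ereal_inf S < m%:R%:E)%E by rewrite -dimE -(fineK dim_fin) lte_fin.
  by move=> /ereal_inf_lt [_ [t tS <-]]; rewrite lte_fin; exists t.
have {t0} t0 := hausdorff_measure0_gt0 _ _ ne t0 Ht.
have [G [covG szG sumG]] := prefix_cover_of_hausdorff0 a0 a1 c1p bounds _ cpt t0 Ht.
have ml := powR_gt_exprn _ _ _ a01 tm.
have l01 : 0 < alpha `^ t <= 1.
  have := ge0_ler_powR (ltW t0) _ _ (ltW a1); rewrite powR1 powR_gt0 //=.
  by apply; rewrite nnegrE ltW.
have [C C0 growth] := live_words_growth _ _ _ _ _ l01 covG szG sumG.
have [K [M [K0 M0 b6 Mb NM]]] := block_length_exists _ _ _ _ a01 ml C0.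
have b0 : 0 < alpha ^+ K by rewrite exprn_gt0.
have [F FP] := block_embedding s r m K M _ K0 M0 b0 b6 Mb (NM _ (growth K)).
set b := alpha ^+ K in b0 b6 Mb FP.
have b1 : 0 < 1 - b.
  by rewrite subr_gt0; apply: le_lt_trans b6 _; rewrite invf_lt1 ?ltr1n.
(* The images are at least b^(k / K) / 2 >= alpha^k / 2 apart, while rho <= c2 alpha^k. *)
pose cm : R := (2 * c2)^-1.
have cm0 : 0 < cm by rewrite invr_gt0 mulr_gt0.
(* Rounding k down to a multiple of K costs at most one factor b, and rho >= c1 alpha^(k+1). *)
pose cp : R := m%:R * (M%:R / (1 - b)) / (c1 * alpha * b).
have ca0 : 0 < c1 * alpha * b by rewrite !mulr_gt0.
have cp0 : 0 <= cp.
  by apply: divr_ge0 (ltW ca0); apply: mulr_ge0 => //; exact: divr_ge0 (ltW b1).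
(* Taking [cm + cp] as upper constant yields [c_minus <= c_plus] without comparing [cm] and [cp]. *)
exists (fun x => F (edges x)), cm, (cm + cp); split=> //; first by rewrite lerDl.
move=> x y; have [->|xy] := pselect (x = y).
  rewrite rho_refl !mulr0 subrr /euclidean_norm big1 ?sqrtr0 ?lexx //.
  by move=> i _; rewrite mxE expr0n.
have [k [eqk nek]] := first_difference x y xy.
have /andP[lo hi] := FP _ _ _ (edges_path x) (edges_path y) eqk nek.
have /andP[rlo rhi] := bounds _ _ _ eqk nek.
have [rho_ge0 _ _ _] := let: And3 u _ _ := ssu in u.
have bE : b ^+ (k %/ K) = alpha ^+ (k %/ K * K) by rewrite /b -exprM mulnC.
apply/andP; split.
  apply: le_trans lo; apply: le_trans (ler_wpM2l (ltW cm0) rhi) _.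
  have -> : cm * (c2 * alpha ^+ k) = alpha ^+ k / 2.
    by rewrite /cm; field; rewrite gt_eqF.
  by rewrite ler_pM2r ?invr_gt0 // bE ler_wiXn2l ?(ltW a0) ?(ltW a1) // leq_divM.
apply: le_trans hi _; apply: (@le_trans _ _ (cp * rho x y)); last first.
  by rewrite ler_wpM2r // lerDr ltW.
apply: le_trans (ler_wpM2l cp0 rlo).
have -> : cp * (c1 * alpha ^+ k.+1) = m%:R * (M%:R * (alpha ^+ k / b) / (1 - b)).
  by rewrite /cp exprS; field; rewrite !gt_eqF.
rewrite ler_wpM2l // ler_wpM2r ?invr_ge0 ?(ltW b1) // ler_wpM2l //.
rewrite ler_pdivlMr // bE -exprD ler_wiXn2l ?(ltW a0) ?(ltW a1) //.
by rewrite -mulSnr ltnW // ltn_ceil.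
Qed.
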